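(* If $G$ and $H$ are graphs, then $$\begin{aligned}M(G\oplus H;x,y)={}&\sum_{i\le i'}\ \sum_{j,j'} m_{i,i'}(G)\,\widehat m_{j,j'}(H)\,x^{\min\{\delta_{\oplus}(i,j),\,\delta_{\oplus}(i',j')\}}\,y^{\max\{\delta_{\oplus}(i,j),\,\delta_{\oplus}(i',j')\}}\\&+\sum_{j\le j'}\ \sum_{i,i'} m_{j,j'}(H)\,\widehat m_{i,i'}(G)\,x^{\min\{\delta_{\oplus}(i,j),\,\delta_{\oplus}(i',j')\}}\,y^{\max\{\delta_{\oplus}(i,j),\,\delta_{\oplus}(i',j')\}},\end{aligned}$$ where $\delta_{\oplus}(i,j)=i\,n_H+j\,n_G-2ij$.
   Context: All graphs are finite, simple, and undirected; $n_G=|V(G)|$ and $\deg_G(g)$ is the degree of $g\in V(G)$. For $i\le j$ let $m_{i,j}(G)=|\{\{g,g'\}\in E(G): \{\deg_G(g),\deg_G(g')\}=\{i,j\}\}|$. For arbitrary $i,j$, let $\widehat m_{i,j}(G)=|\{(g,g')\in V(G)^2: gg'\notin E(G),\ (\deg_G(g),\deg_G(g'))=(i,j)\}|$, where $g=g'$ is allowed. The M-polynomial of $G$ is $M(G;x,y)=\sum_{i\le j} m_{i,j}(G)\,x^iy^j$. The symmetric-difference product $G\oplus H$ has vertex set $V(G)\times V(H)$; vertices $(g_1,h_1)$ and $(g_2,h_2)$ are adjacent if exactly one of $g_1g_2\in E(G)$ and $h_1h_2\in E(H)$ holds. The quantity $\delta_{\oplus}(i,j)$ is the degree in $G\oplus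 H$ of any vertex $(g,h)$ with $\deg_G(g)=i$, $\deg_H(h)=j$. Indices $i,i'$ range over vertex degrees of $G$ and $j,j'$ over vertex degrees of $H$; the sums over $j,j'$ (resp. $i,i'$) without an inequality are over all ordered pairs. *)

(* Defs.v *)
From mathcomp Require Import all_boot all_order all_algebra.
From mathcomp Require Import mpoly.

Set Implicit Arguments.
Unset Strict Implicit.
Unset Printing Implicit Defensive.

Import GRing.Theory.

Record sgraph := SGraph {
  vert :> finType;
  adj : rel vert;
  adj_sym : ssrbool.symmetric adj;
  adj_irr : irreflexive adj
}.

Section Graph.

Variable G : sgraph.

Definition nvert := #|G|.

Definition edges : {set {set G}} :=
  [set [set p.1; p.2] | p : G * G & adj p.1 p.2].

Definition deg (g : G) := #|[set g' : G | adj g g']|.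

Definition degrees : seq nat := undup [seq deg g | g : G].

(* An edge has exactly two elements, so perm_eq says {deg g, deg g'} = {i, j}. *)
Definition medge (i j : nat) :=
  #|[set e in edges | perm_eq [seq deg g | g in e] [:: i; j]]|.

(* Ordered pairs; the diagonal is included, by irreflexivity of adj. *)
Definition mhat (i j : nat) :=
  #|[set p : G * G | ~~ adj p.1 p.2 & (deg p.1, deg p.2) == (i, j)]|.

End Graph.

Section SymDiff.

Variables G H : sgraph.

Definition symdiff_adj : rel (G * H) :=
  fun u v => adj u.1 v.1 (+) adj u.2 v.2.

Fact symdiff_adj_sym : ssrbool.symmetric symdiff_adj.
Proof. by move=> u v; rewrite /symdiff_adj adj_sym [adj u.2 _]adj_sym. Qed.

Fact symdiff_adj_irr : irreflexive symdiff_adj.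
Proof. by move=> u; rewrite /symdiff_adj !adj_irr. Qed.

Definition symdiff : sgraph := SGraph symdiff_adj_sym symdiff_adj_irr.

(* The subtraction on nat does not truncate on vertex degrees: see
   delta_subn_le. *)
Definition delta (i j : nat) : nat := i * nvert H + j * nvert G - 2 * i * j.

Lemma delta_subn_le (g : G) (h : H) :
  2 * deg g * deg h <= deg g * nvert H + deg h * nvert G.
Proof.
by rewrite mul2n -addnn mulnDl leq_add ?[deg h * _]mulnC ?leq_mul ?max_card.
Qed.

End SymDiff.

Notation "G '\oplus' H" := (symdiff G H) (at level 50, left associativity).

Local Open Scope ring_scope.

Definition varx : {mpoly int[2]} := 'X_ord0.
Definition vary : {mpoly int[2]} := 'X_ord_max.

Definition Mpoly (G : sgraph) : {mpoly int[2]} :=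
  \sum_(i <- degrees G) \sum_(j <- degrees G | (i <= j)%N)
    (medge G i j)%:R * varx ^+ i * vary ^+ j.

(* Main.v *)
(** Doubling turns a sum over unordered edges, weighted by a symmetric function
    of the two end degrees, into a sum over ordered adjacent pairs. In this
    form the theorem is immediate: an ordered pair of vertices of [G \oplus H]
    is adjacent iff it is adjacent in [G] and not in [H], or vice versa. The
    factor 2 cancels because [{mpoly int[2]}] is torsion-free. *)

Require Import Defs.
From mathcomp Require Import all_boot all_order all_algebra.
From mathcomp Require Import mpoly.
From mathcomp Require Import zify.

Import GRing.Theory.
Local Open Scope ring_scope.

Set Implicit Arguments.
Unset Strict Implicit.
Unset Printing Implicit Defensive.

Section DegreeSums.

Variables (G : sgraph) (R : pzRingType).
Implicit Types (u v : G) (F : nat -> nat -> R).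

Lemma adj_neq u v : adj u v -> u != v.
Proof. by apply: contraTneq => ->; rewrite adj_irr. Qed.

Lemma deg_degrees u : deg u \in degrees G.
Proof. by rewrite mem_undup; apply/mapP; exists u; rewrite ?mem_enum. Qed.

Lemma sum_degrees_eq u (f : nat -> R) :
  \sum_(i <- degrees G | deg u == i) f i = f (deg u).
Proof.
rewrite -big_filter; under eq_filter => i do rewrite eq_sym.
by rewrite filter_pred1_uniq ?undup_uniq ?deg_degrees // big_seq1.
Qed.

(** Each non-adjacent ordered pair lies in exactly one degree class [(j, j')], so expanding [mhat]
    as a sum of indicators and exchanging the sums leaves one term per pair. *)
Lemma mhat_sum F :
  \sum_(j <- degrees G) \sum_(j' <- degrees G) (mhat G j j')%:R * F j j' =
  \sum_(p : G * G | ~~ adj p.1 p.2) F (deg p.1) (deg p.2).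
Proof.
have expand j j' : (mhat G j j')%:R * F j j' =
    \sum_(p : G * G | ~~ adj p.1 p.2)
      if deg p.1 == j then if deg p.2 == j' then F j j' else 0 else 0.
  rewrite /mhat -sum1_card natr_sum mulr_suml.
  under eq_bigl => p do rewrite inE.
  rewrite big_mkcondr; apply: eq_bigr => p _.
  by rewrite xpair_eqE mul1r; do 2!case: eqP.
under eq_bigr => j _ do (under eq_bigr => j' _ do rewrite expand;
  rewrite exchange_big /=).
rewrite exchange_big; apply: eq_bigr => p _ /=.
rewrite -(sum_degrees_eq p.1 (F^~ (deg p.2))) [RHS]big_mkcond.
apply: eq_bigr => j _; case: eqP => _; last by rewrite big1.
by rewrite -big_mkcond sum_degrees_eq.
Qed.

(** Serves to show that the inner sums over one factor are symmetric, as [medge_sum] demands of its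
    weight. *)
Lemma nonadj_swap_sum F :
  \sum_(p : G * G | ~~ adj p.1 p.2) F (deg p.1) (deg p.2) =
  \sum_(p : G * G | ~~ adj p.1 p.2) F (deg p.2) (deg p.1).
Proof.
rewrite (reindex_inj (can_inj (@swap_pairK G G))) /=.
by apply: eq_bigl => p; rewrite adj_sym.
Qed.

Lemma perm_edge_degrees u v i j : adj u v ->
  perm_eq [seq deg g | g in [set u; v]] [:: i; j] =
  perm_eq [:: deg u; deg v] [:: i; j].
Proof.
move=> uv; have neq_uv := adj_neq uv.
have enum_uv : perm_eq (enum [set u; v]) [:: u; v].
  apply: uniq_perm; rewrite ?enum_uniq //= ?inE ?neq_uv //.
  by move=> x; rewrite mem_enum !inE.
by have /permPl -> := perm_map (@deg G) enum_uv.
Qed.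

(** Two permuted lists have the same sorted form, and that of [[:: a; b]] is its minimum followed by
    its maximum. *)
Lemma perm_eq_pair_le (a b i j : nat) :
  (i <= j)%N && perm_eq [:: a; b] [:: i; j] =
  (minn a b == i) && (maxn a b == j).
Proof.
wlog leab : a b / (a <= b)%N.
  move=> IH; case/orP: (leq_total a b) => /IH //.
  by rewrite minnC maxnC => <-; rewrite (perm_catC [:: a] [:: b]).
rewrite (minn_idPl leab) (maxn_idPr leab).
apply/idP/andP => [/andP[leij ij]|[/eqP <- /eqP <-]]; last by rewrite leab /=.
have : sort leq [:: a; b] = sort leq [:: i; j].
  by apply/perm_sortP => //; [exact: leq_total|exact: leq_trans|exact: anti_leq].
rewrite !sorted_sort ?/= ?leab ?leij //; try exact: leq_trans.
by case=> -> ->.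
Qed.

Lemma edge_degree_sum F u v : (forall i j, F i j = F j i) -> adj u v ->
  \sum_(i <- degrees G) \sum_(j <- degrees G | (i <= j)%N)
    (perm_eq [seq deg g | g in [set u; v]] [:: i; j])%:R * F i j =
  F (deg u) (deg v).
Proof.
move=> symF uv.
have minmax : F (minn (deg u) (deg v)) (maxn (deg u) (deg v)) =
    F (deg u) (deg v) by case: leqP.
(* Name the ends of the edge in order of degree: [sum_degrees_eq] needs both the minimum and the
   maximum to be degrees of actual vertices. *)
have [a [b [eq_a eq_b]]] : exists a b : G,
    deg a = minn (deg u) (deg v) /\ deg b = maxn (deg u) (deg v).
  by case: (leqP (deg u) (deg v)) => _; [exists u, v|exists v, u].
rewrite -minmax -eq_a -eq_b -(sum_degrees_eq a (F^~ (deg b))) [RHS]big_mkcond.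
apply: eq_bigr => i _ /=.
have key j : (i <= j)%N && perm_eq [seq deg g | g in [set u; v]] [:: i; j] =
    (deg a == i) && (deg b == j).
  by rewrite perm_edge_degrees // perm_eq_pair_le eq_a eq_b.
transitivity (\sum_(j <- degrees G)
    if (deg a == i) && (deg b == j) then F i j else 0).
  rewrite big_mkcond; apply: eq_bigr => j _; rewrite -key.
  by case: leq => //=; case: perm_eq; rewrite ?mul1r ?mul0r.
case: eqP => _ /=; last by rewrite big1.
by rewrite -big_mkcond sum_degrees_eq.
Qed.

Lemma sum_orientations (Phi : G * G -> R) u v : adj u v ->
  \sum_(p : G * G | adj p.1 p.2 && ([set p.1; p.2] == [set u; v])) Phi p =
  Phi (u, v) + Phi (v, u).
Proof.
move=> uv; have neq_uv := adj_neq uv.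
rewrite (bigD1 (u, v)) /= ?uv ?eqxx // (bigD1 (v, u)) /=; last first.
  by rewrite adj_sym uv setUC eqxx xpair_eqE negb_and eq_sym neq_uv.
rewrite big1 ?addr0 // => -[a b] /= /andP[/andP[/andP[ab /eqP eqs]]].
(* Of the four ways to place [a] and [b] in [{u, v}], two make a loop and the other two are the
   orientations already split off. *)
have := set21 a b; have := set22 a b; rewrite eqs !inE !xpair_eqE.
by case/orP=> /eqP eb; case/orP=> /eqP ea; move: ab;
  rewrite ea eb ?adj_irr ?eqxx.
Qed.

(** Group the ordered adjacent pairs by the edge they span. Each fibre consists of the two
    orientations, which have equal weight by symmetry of [F]. *)
Lemma medge_sum F : (forall i j, F i j = F j i) ->
  (\sum_(i <- degrees G) \sum_(j <- degrees G | (i <= j)%N)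
    (medge G i j)%:R * F i j) *+ 2 =
  \sum_(p : G * G | adj p.1 p.2) F (deg p.1) (deg p.2).
Proof.
move=> symF.
have expand i j : (medge G i j)%:R * F i j =
    \sum_(e in edges G) (perm_eq [seq deg g | g in e] [:: i; j])%:R * F i j.
  rewrite /medge -sum1_card natr_sum !mulr_suml.
  under eq_bigl => e do rewrite inE.
  by rewrite big_mkcondr; apply: eq_bigr => e _; case: ifP; rewrite ?mul0r.
under eq_bigr => i _ do (under eq_bigr => j _ do rewrite expand;
  rewrite exchange_big /=).
rewrite exchange_big -sumrMnl /=.
rewrite [RHS](partition_big (fun p => [set p.1; p.2]) (mem (edges G))) /=; last first.
  by move=> p adjp; apply/imsetP; exists p; rewrite ?inE.
apply: eq_bigr => _ /imsetP[[u v] + ->]; rewrite inE /= => uv.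
rewrite edge_degree_sum //.
rewrite (sum_orientations (fun p => F (deg p.1) (deg p.2)) uv) /=.
by rewrite mulr2n [F (deg v) _]symF.
Qed.

End DegreeSums.

Lemma mpoly_int_mulr2n_inj (n : nat) :
  injective (fun p : {mpoly int[n]} => p *+ 2).
Proof.
move=> p q eqpq; apply/mpolyP => m.
have := congr1 (fun r => r@_m) eqpq; rewrite !mcoeffMn.
by move/eqP; rewrite Num.Theory.eqrMn2r // => /eqP.
Qed.

(** The neighbourhood is the disjoint union of [A] times the complement of [B] and the complement of
    [A] times [B], for the neighbourhoods [A] of [g] and [B] of [h]. *)
Lemma deg_symdiff (G H : sgraph) (g : G) (h : H) :
  @deg (G \oplus H) (g, h) = delta G H (deg g) (deg h).
Proof.
rewrite /deg; set A := [set g' | adj g g']; set B := [set h' | adj h h'].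
have -> : [set w | symdiff_adj (g, h) w] =
    setX A (~: B) :|: setX (~: A) B.
  by apply/setP => -[g' h']; rewrite !inE /symdiff_adj /=; do 2!case: adj.
have AB0 : setX A (~: B) :&: setX (~: A) B = set0.
  by apply/setP => -[g' h']; rewrite !inE; do 2!case: adj.
(* With both orders split as a set plus its complement, the products expand and [2 * #|A| * #|B|]
   cancels without truncation. *)
rewrite cardsU AB0 cards0 !cardsX /delta /nvert -(cardsC A) -(cardsC B).
by lia.
Qed.

Theorem theorem3p7 (G H : sgraph) :
  (forall (g : G) (h : H),
     @deg (G \oplus H) (g, h) = delta G H (deg g) (deg h)) /\
  Mpoly (G \oplus H) =
    \sum_(i <- degrees G) \sum_(i' <- degrees G | (i <= i')%N)
    \sum_(j <- degrees H) \sum_(j' <- degrees H)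
      (medge G i i')%:R * (mhat H j j')%:R
        * varx ^+ minn (delta G H i j) (delta G H i' j')
        * vary ^+ maxn (delta G H i j) (delta G H i' j')
  + \sum_(j <- degrees H) \sum_(j' <- degrees H | (j <= j')%N)
    \sum_(i <- degrees G) \sum_(i' <- degrees G)
      (medge H j j')%:R * (mhat G i i')%:R
        * varx ^+ minn (delta G H i j) (delta G H i' j')
        * vary ^+ maxn (delta G H i j) (delta G H i' j').
Proof.
split=> [g h|]; first exact: deg_symdiff.
(* A symmetric weight that agrees with the monomial of [Mpoly] whenever [a <= b], so that
   [medge_sum] applies. *)
pose W a b : {mpoly int[2]} := varx ^+ minn a b * vary ^+ maxn a b.
have symW a b : W a b = W b a by rewrite /W minnC maxnC.
apply: mpoly_int_mulr2n_inj; rewrite /= mulrnDl.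
have -> : Mpoly (G \oplus H) *+ 2 =
    \sum_(p : (G \oplus H) * (G \oplus H) | adj p.1 p.2) W (deg p.1) (deg p.2).
  rewrite -medge_sum // /Mpoly; congr (_ *+ 2).
  apply: eq_bigr => i _; apply: eq_bigr => j leij.
  by rewrite /W (minn_idPl leij) (maxn_idPr leij) mulrA.
pose FG i i' := \sum_(j <- degrees H) \sum_(j' <- degrees H)
  (mhat H j j')%:R * W (delta G H i j) (delta G H i' j').
pose FH j j' := \sum_(i <- degrees G) \sum_(i' <- degrees G)
  (mhat G i i')%:R * W (delta G H i j) (delta G H i' j').
have FGE i i' : FG i i' = \sum_(q : H * H | ~~ adj q.1 q.2)
    W (delta G H i (deg q.1)) (delta G H i' (deg q.2)).
  exact: (mhat_sum H (fun j j' => W (delta G H i j) (delta G H i' j'))).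
have FHE j j' : FH j j' = \sum_(p : G * G | ~~ adj p.1 p.2)
    W (delta G H (deg p.1) j) (delta G H (deg p.2) j').
  exact: (mhat_sum G (fun i i' => W (delta G H i j) (delta G H i' j'))).
(* Exchanging [i] and [i'] alone changes individual terms; reversing the pairs in [H] as well
   exchanges the two arguments of the symmetric [W]. *)
have symFG i i' : FG i i' = FG i' i.
  rewrite !FGE (nonadj_swap_sum H
    (fun j j' => W (delta G H i j) (delta G H i' j'))) /=.
  by apply: eq_bigr => q _; rewrite symW.
have symFH j j' : FH j j' = FH j' j.
  rewrite !FHE (nonadj_swap_sum G
    (fun i i' => W (delta G H i j) (delta G H i' j'))) /=.
  by apply: eq_bigr => p _; rewrite symW.
have -> : (\sum_(i <- degrees G) \sum_(i' <- degrees G | (i <= i')%N)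
    \sum_(j <- degrees H) \sum_(j' <- degrees H)
      (medge G i i')%:R * (mhat H j j')%:R
        * varx ^+ minn (delta G H i j) (delta G H i' j')
        * vary ^+ maxn (delta G H i j) (delta G H i' j')) *+ 2 =
    \sum_(p : G * G | adj p.1 p.2) FG (deg p.1) (deg p.2).
  rewrite -medge_sum //; congr (_ *+ 2).
  apply: eq_bigr => i _; apply: eq_bigr => i' _; rewrite mulr_sumr.
  apply: eq_bigr => j _; rewrite mulr_sumr.
  by apply: eq_bigr => j' _; rewrite /W !mulrA.
have -> : (\sum_(j <- degrees H) \sum_(j' <- degrees H | (j <= j')%N)
    \sum_(i <- degrees G) \sum_(i' <- degrees G)
      (medge H j j')%:R * (mhat G i i')%:R
        * varx ^+ minn (delta G H i j) (delta G H i' j')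
        * vary ^+ maxn (delta G H i j) (delta G H i' j')) *+ 2 =
    \sum_(q : H * H | adj q.1 q.2) FH (deg q.1) (deg q.2).
  rewrite -medge_sum //; congr (_ *+ 2).
  apply: eq_bigr => j _; apply: eq_bigr => j' _; rewrite mulr_sumr.
  apply: eq_bigr => i _; rewrite mulr_sumr.
  by apply: eq_bigr => i' _; rewrite /W !mulrA.
under [X in _ = X + _]eq_bigr => p _ do rewrite FGE.
under [X in _ = _ + X]eq_bigr => q _ do rewrite FHE.
(* Bring both double sums to the same index: a pair in [G] followed by a pair in [H]. *)
rewrite pair_big_dep (exchange_big_dep xpredT) //= pair_big_dep /=.
(* Regroups a pair in [G] and a pair in [H] into a pair of product vertices. *)
pose zip4 (x : (G * G) * (H * H)) : (G \oplus H) * (G \oplus H) :=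
  ((x.1.1, x.2.1), (x.1.2, x.2.2)).
have zip4_bij : bijective zip4.
  by exists (fun w => ((w.1.1, w.2.1), (w.1.2, w.2.2))); case=> -[? ?] [? ?].
rewrite (reindex zip4) /=; last exact: onW_bij.
(* Once adjacency in [G] is decided, the exclusive or fixes adjacency in [H], which yields the two
   sums. *)
rewrite (bigID (fun x => adj x.1.1 x.1.2)) /=.
by congr (_ + _); apply: eq_big => [x|x _]; rewrite ?deg_symdiff //
  /symdiff_adj /=; do 2!case: adj.
Qed.
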